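(* For all $k,p\in\mathbb{N}$ with $k\geqslant 1$ there exist constants $c,d\in\mathbb{N}$, depending only on $k$ and $p$, such that for all $m\in\mathbb{N}$: $F_{k,p}(m)\leqslant c\cdot(m+2)^d$.
   Context: Let $\mathcal{G}$ be a finite signature with a precedence (preorder) $\succeq$, strict part $\succ$, equivalence $\sim$. The rank is $\mathrm{rk}(f)=\max\{1+\mathrm{rk}(g)\mid f\succ g\}$ (maximum of the empty set is $0$). With a fresh variadic symbol for sequences, ground terms (with sequence arguments) and ground sequences are defined mutually: if $a_1,\dots,a_n$ ($n\geqslant0$) are ground terms then $[a_1\cdots a_n]$ is a ground sequence; if $a_1,\dots,a_n$ are ground sequences and $f\in\mathcal{G}$ is $n$-ary then $f(a_1,\dots,a_n)$ is a ground term. A term $a$ is identified with the singleton $[a]$; $a \mathbin{+\!\!+} b$ is concatenation. Width: $w(f(a_1,\dots,a_n))=\max\{1,w(a_1),\dots,w(a_n)\}$, $w([a_1\cdots a_n])=\sum_i w(a_i)$. Equivalence $\approx$: $a\approx b$ iff $a=b$ or there is a permutation $\pi$ with $a_i\approx b_{\pi(i)}$ for all $i$, where either $a=[a_1\cdots a_n]$, $b=[b_1\cdots b_n]$, or $a=f(a_1,\dots,a_n)$, $b=g(b_1,\dots,b_n)$ with $f\sim g$. For $k,l\geqslant1$ define $\sqsupset_{k,l}$ inductively (relations with second index $0$ are empty), with ${\sqsupseteq_{k,l}}={\sqsupset_{k,l}}\cup{\approx}$: (1) $f(a_1,\dots,a_n)\sqsupset_{k,l}b$ if $a_i\sqsupseteq_{k,l}b$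 for some $i$; (2) $f(\vec a)\sqsupset_{k,l}g(b_1,\dots,b_m)$ if $f\succ g$, $f(\vec a)\sqsupset_{k,l-1}b_j$ for all $j$, and $m\leqslant k$; (3) $f(\vec a)\sqsupset_{k,l}[b_1\cdots b_m]$ if $f(\vec a)\sqsupset_{k,l-1}b_j$ for all $j$ and $m\leqslant w(f(\vec a))+k$; (4) $[a_1\cdots a_n]\sqsupset_{k,l}[b_1\cdots b_m]$ if $[b_1\cdots b_m]\approx c_1\mathbin{+\!\!+}\cdots\mathbin{+\!\!+}c_n$ with $a_i\sqsupseteq_{k,l}c_i$ for all $i$, $a_{i_0}\sqsupset_{k,l}c_{i_0}$ for some $i_0$, and $m\leqslant w([a_1\cdots a_n])+k$. Let $>_{k,l}$ be the least extension of $\sqsupset_{k,l}$ (with ${\geqslant_{k,l}}={>_{k,l}}\cup{\approx}$) such that: (1) $f(a_1,\dots,a_n)>_{k,l}b$ if $a_i\geqslant_{k,l}b$ for some $i$; (2) $f(a_1,\dots,a_n)>_{k,l}g(b_1,\dots,b_m)$ if $f\sim g$, $\{a_1,\dots,a_n\}$ is greater than $\{b_1,\dots,b_m\}$ in the multiset extension of $>_{k,l}$ modulo $\approx$, and $m\leqslant k$; (3) $f(\vec a)>_{k,l}[b_1\cdots b_m]$ if $f(\vec a)>_{k,l-1}b_{j_0}$ for at most one $j_0$, $f(\vec a)\sqsupset_{k,l-1}b_j$ for all $j\neq j_0$, and $m\leqslant w(f(\vec a))+k$; (4) as clause (4) of $\sqsupset_{k,l}$ with $\geqslant_{k,l}$,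 $>_{k,l}$ in place of $\sqsupseteq_{k,l},\sqsupset_{k,l}$. Set $>_k={>_{k,k}}$. For ground $a$ let $\mathrm{Slow}_k(a)=1+\max\{\mathrm{Slow}_k(b)\mid b\text{ ground},\ a>_k b\}$ (max of empty set $0$). For $n\leqslant k$ and $c\in\mathbb{N}$ let $h^n_{k,c}(m_1,\dots,m_n)=\sum_{i=1}^n \mathrm{sort}_i(m_1,\dots,m_n)\cdot c^{k-i}$, where $\mathrm{sort}_i$ is the $i$-th largest element. Let $\mathrm{MSlow}_{n,k}(a_1,\dots,a_n)=h^n_{k,c}(\mathrm{Slow}_k(a_1),\dots,\mathrm{Slow}_k(a_n))$ with $c=1+\max_i\mathrm{Slow}_k(a_i)$. Finally $F_{k,p}(m)=\max\{\mathrm{Slow}_k(f(a_1,\dots,a_n))\mid f(a_1,\dots,a_n)\text{ ground term},\ \mathrm{rk}(f)\leqslant p,\ n\leqslant k,\ \mathrm{MSlow}_{n,k}(a_1,\dots,a_n)\leqslant m\}$. *)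

(* Defs.v *)
From mathcomp Require Import all_boot.
From Stdlib Require List Permutation ClassicalEpsilon.

Set Implicit Arguments.
Unset Strict Implicit.
Unset Printing Implicit Defensive.

Record signature := Signature {
  symbol :> finType;
  arity : symbol -> nat;
  prec : rel symbol;
  prec_refl : reflexive prec;
  prec_trans : transitive prec }.

Definition prec_gt (G : signature) (f g : G) := prec f g && ~~ prec g f.

Definition prec_eq (G : signature) (f g : G) := prec f g && prec g f.

(* The first argument is fuel; #|G| units suffice, as [rkE] shows. *)
Fixpoint rk_rec (G : signature) (n : nat) (f : G) : nat :=
  if n is n'.+1 then \max_(g : G | prec_gt f g) (rk_rec n' g).+1 else 0.

Definition rk (G : signature) (f : G) : nat := rk_rec #|G| f.

Lemma prec_gt_trans (G : signature) (f g h : G) :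
  prec_gt f g -> prec_gt g h -> prec_gt f h.
Proof.
move=> /andP[fg ngf] /andP[gh nhg]; apply/andP; split.
  exact: prec_trans fg gh.
by apply: contra ngf => hf; apply: prec_trans gh hf.
Qed.

Lemma rk_rec_fuel (G : signature) (n1 n2 : nat) (f : G) :
  #|[pred g | prec_gt f g]| < n1 -> #|[pred g | prec_gt f g]| < n2 ->
  rk_rec n1 f = rk_rec n2 f.
Proof.
elim: n1 n2 f => [|n1 IH] [|n2] f //; rewrite !ltnS => h1 h2 /=.
apply: eq_bigr => g fg; congr _.+1.
have lt : #|[pred h | prec_gt g h]| < #|[pred h | prec_gt f h]|.
  apply: proper_card; apply/properP; split.
    by apply/subsetP => h; rewrite !inE; apply: prec_gt_trans.
  by exists g; rewrite !inE // /prec_gt andbN.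
by apply: IH; apply: leq_trans lt _.
Qed.

Lemma rkE (G : signature) (f : G) :
  rk f = \max_(g : G | prec_gt f g) (rk g).+1.
Proof.
have lt (g : G) : #|[pred h | prec_gt g h]| < #|G|.
  apply: proper_card; apply/properP; split; first exact: subset_predT.
  by exists g; rewrite !inE // /prec_gt andbN.
by rewrite {1}/rk (@rk_rec_fuel _ _ #|G|.+1) // ltnS ltnW.
Qed.

(* A sequence is a list of terms, and a term [t] counts as the sequence       *)
(* [:: t]; every relation below is therefore stated on sequences.  Arities    *)
(* are not enforced by the type but by [ground].                              *)
Inductive term (G : signature) : Type :=
  Term of G & seq (seq (term G)).

Notation sequence G := (seq (term G)).

Fixpoint ground_term (G : signature) (t : term G) : bool :=
  let: Term f a := t in (size a == arity f) && all (all (@ground_term G)) a.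

Definition ground (G : signature) (a : sequence G) : bool :=
  all (@ground_term G) a.

Fixpoint width_term (G : signature) (t : term G) : nat :=
  let: Term _ a := t in
  foldr maxn 1 [seq sumn [seq width_term t' | t' <- s] | s <- a].

Definition width (G : signature) (a : sequence G) : nat :=
  sumn [seq width_term t | t <- a].

Inductive equiv (G : signature) : sequence G -> sequence G -> Prop :=
| equiv_refl a : equiv a a
| equiv_seq (a b b' : sequence G) :
    Permutation.Permutation b b' ->
    List.Forall2 (fun s t => equiv [:: s] [:: t]) a b' ->
    equiv a b
| equiv_term (f g : G) (a b b' : seq (sequence G)) :
    prec_eq f g ->
    Permutation.Permutation b b' ->
    List.Forall2 (@equiv G) a b' ->
    equiv [:: Term f a] [:: Term g b].

(* All constructors conclude at a successor second index, so that the         *)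
(* relations with second index 0 are empty.                                   *)
Inductive sqgt (G : signature) (k : nat) :
    nat -> sequence G -> sequence G -> Prop :=
| sqgt_arg l (f : G) (a : seq (sequence G)) (ai b : sequence G) :
    List.In ai a ->
    sqgt k l.+1 ai b \/ equiv ai b ->
    sqgt k l.+1 [:: Term f a] b
| sqgt_prec l (f g : G) (a b : seq (sequence G)) :
    prec_gt f g ->
    (forall bj, List.In bj b -> sqgt k l [:: Term f a] bj) ->
    size b <= k ->
    sqgt k l.+1 [:: Term f a] [:: Term g b]
| sqgt_to_seq l (f : G) (a : seq (sequence G)) (b : sequence G) :
    (forall bj, List.In bj b -> sqgt k l [:: Term f a] [:: bj]) ->
    size b <= width [:: Term f a] + k ->
    sqgt k l.+1 [:: Term f a] b
| sqgt_seq l (a b : sequence G) (c : seq (sequence G)) a0 c0 :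
    size c = size a ->
    equiv b (flatten c) ->
    (forall ai ci, List.In (ai, ci) (zip a c) ->
       sqgt k l.+1 [:: ai] ci \/ equiv [:: ai] ci) ->
    List.In (a0, c0) (zip a c) ->
    sqgt k l.+1 [:: a0] c0 ->
    size b <= width a + k ->
    sqgt k l.+1 a b.

(* Dershowitz-Manna extension of R modulo E: the nonempty part x is replaced  *)
(* by the part y, and the remaining elements are kept up to E.                *)
Inductive mulext (T : Type) (E R : T -> T -> Prop) (a b : seq T) : Prop :=
| Mulext (x y z z' : seq T) :
    Permutation.Permutation a (x ++ z) ->
    Permutation.Permutation b (y ++ z') ->
    List.Forall2 E z z' ->
    x <> [::] ->
    (forall v, List.In v y -> exists2 u, List.In u x & R u v) ->
    mulext E R a b.

(* In [gt_to_seq], the list o holds the at most one exceptional element.      *)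
Inductive gt (G : signature) (k : nat) :
    nat -> sequence G -> sequence G -> Prop :=
| gt_sqgt l (a b : sequence G) :
    sqgt k l a b ->
    gt k l a b
| gt_arg l (f : G) (a : seq (sequence G)) (ai b : sequence G) :
    List.In ai a ->
    gt k l.+1 ai b \/ equiv ai b ->
    gt k l.+1 [:: Term f a] b
| gt_mul l (f g : G) (a b : seq (sequence G)) :
    prec_eq f g ->
    mulext (@equiv G) (gt k l.+1) a b ->
    size b <= k ->
    gt k l.+1 [:: Term f a] [:: Term g b]
| gt_to_seq l (f : G) (a : seq (sequence G)) (b1 o b2 : sequence G) :
    size o <= 1 ->
    (forall bj, List.In bj o -> gt k l [:: Term f a] [:: bj]) ->
    (forall bj, List.In bj (b1 ++ b2) -> sqgt k l [:: Term f a] [:: bj]) ->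
    size (b1 ++ o ++ b2) <= width [:: Term f a] + k ->
    gt k l.+1 [:: Term f a] (b1 ++ o ++ b2)
| gt_seq l (a b : sequence G) (c : seq (sequence G)) a0 c0 :
    size c = size a ->
    equiv b (flatten c) ->
    (forall ai ci, List.In (ai, ci) (zip a c) ->
       gt k l.+1 [:: ai] ci \/ equiv [:: ai] ci) ->
    List.In (a0, c0) (zip a c) ->
    gt k l.+1 [:: a0] c0 ->
    size b <= width a + k ->
    gt k l.+1 a b.

Definition is_max (S : nat -> Prop) (v : nat) : Prop :=
  (forall n, S n -> n <= v) /\ (S v \/ (forall n, ~ S n) /\ v = 0).

(* The maximum of a set of naturals, 0 for the empty set.  It is an           *)
(* unspecified natural, not 0, if the set is unbounded.                       *)
Definition setmax (S : nat -> Prop) : nat :=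
  ClassicalEpsilon.epsilon (inhabits 0) (is_max S).

Definition slow_equation (G : signature) (k : nat) (slow : sequence G -> nat) :=
  forall a, ground a ->
    exists2 v,
      is_max (fun n => exists b, [/\ ground b, gt k k a b & n = slow b]) v
      & slow a = 1 + v.

Lemma slow_equation_unique (G : signature) k (s1 s2 : sequence G -> nat) :
  slow_equation k s1 -> slow_equation k s2 ->
  forall a, ground a -> s1 a = s2 a.
Proof.
move=> h1 h2 a; have [n] := ubnP (s1 a); elim: n a => // n IH a lt ga.
have [v1 [ub1 at1] e1] := h1 a ga; have [v2 [ub2 at2] e2] := h2 a ga.
have eq b : ground b -> gt k k a b -> s1 b = s2 b.
  move=> gb ab; apply: IH => //; rewrite e1 add1n ltnS in lt.
  by apply: leq_ltn_trans lt; apply: ub1; exists b.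
rewrite e1 e2; congr (_ + _); apply/eqP; rewrite eqn_leq; apply/andP; split.
  case: at1 => [[b [gb ab ->]]|[_ ->]] //.
  by rewrite eq //; apply: ub2; exists b.
case: at2 => [[b [gb ab ->]]|[_ ->]] //.
by rewrite -eq //; apply: ub1; exists b.
Qed.

(* The recursive definition of Slow_k is read as its defining equation, which *)
(* has at most one solution on ground sequences.  If it had none, Slow would  *)
(* be an unspecified function.                                                *)
Definition Slow (G : signature) (k : nat) : sequence G -> nat :=
  ClassicalEpsilon.epsilon (inhabits (fun=> 0)) (@slow_equation G k).

(* The i-th largest element of s, counted from 1, is nth 0 (sort geq s) i.-1. *)
Definition h (k c : nat) (s : seq nat) : nat :=
  \sum_(1 <= i < (size s).+1) nth 0 (sort geq s) i.-1 * c ^ (k - i).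

Definition MSlow (G : signature) (k : nat) (a : seq (sequence G)) : nat :=
  h k (1 + \max_(ai <- a) Slow k ai) [seq Slow k ai | ai <- a].

Definition F (G : signature) (k p m : nat) : nat :=
  setmax (fun v => exists (f : G) (a : seq (sequence G)),
    [/\ ground [:: Term f a], rk f <= p, size a <= k, MSlow k a <= m
      & v = Slow k [:: Term f a]]).

(* Main.v *)
(** Write T(t) = 1 + max {S(c) | t >_k c} for a ground term t, where S(c) is
    the sum of T over the terms of c.  As >_k acts on the terms of a sequence
    separately and is compatible with the equivalence, S decreases strictly
    along >_k; as a sequence can be rewritten one term at a time, S is exactly
    Slow - 1.  In particular the width of a is at most Slow a.

    Let f(a) have rank p and arguments of height at most m.  What f(a) reaches
    by the auxiliary order at depth l <= k has height polynomial in m, by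
    induction on l: its symbols have rank below p, and its sequences have
    length at most m + 1 + k.  A step of >_k produces in addition at most one
    term g(b) with f ~ g, whose argument heights are smaller in the multiset
    order.  That order on at most k numbers bounded by m has chains of length
    at most (m+2)^k, so the total height is (m+2)^k times a polynomial. *)

Require Import Defs.
From mathcomp Require Import all_boot.
From mathcomp Require Import zify.
From Stdlib Require List.
From Stdlib Require Import Permutation ClassicalEpsilon.
(* [all_boot] shadows [equiv]. *)
Import Defs.

Set Implicit Arguments.
Unset Strict Implicit.
Unset Printing Implicit Defensive.

Local Notation In := List.In.
Local Notation Forall2 := List.Forall2.

(** * Lists up to permutation *)

Lemma In_cat (T : Type) (x : T) (s t : seq T) :
  In x (s ++ t) <-> In x s \/ In x t.
Proof. exact: List.in_app_iff. Qed.

Lemma In_all (T : Type) (p : pred T) (s : seq T) :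
  all p s <-> forall x, In x s -> p x.
Proof.
elim: s => [|y s IH] //=; split=> [/andP[py /IH ps] x [<-|/ps]|ps] //.
by rewrite ps /=; [apply/IH => x xs; apply: ps; right|left].
Qed.

Lemma Permutation_all (T : Type) (p : pred T) (s t : seq T) :
  Permutation s t -> all p s = all p t.
Proof.
by elim=> //= [x s' t' _ ->|x y s'|s1 s2 s3 _ -> _ ->] //; rewrite andbCA.
Qed.

Lemma Permutation_size (T : Type) (s t : seq T) : Permutation s t -> size s = size t.
Proof. exact: Permutation_length. Qed.

Lemma Permutation_sumn_map (T : Type) (w : T -> nat) (s t : seq T) :
  Permutation s t -> sumn (map w s) = sumn (map w t).
Proof. by elim=> //= *; lia. Qed.

Lemma Permutation_flatten (T : Type) (s t : seq (seq T)) :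
  Permutation s t -> Permutation (flatten s) (flatten t).
Proof.
elim=> //= [x s' t' _ IH|x y s'|s1 s2 s3 _ h1 _ h2].
- exact: Permutation_app_head.
- by rewrite !catA; apply: Permutation_app_tail; apply: Permutation_app_comm.
- exact: Permutation_trans h1 h2.
Qed.

Lemma Forall2_size (T U : Type) (R : T -> U -> Prop) s t :
  Forall2 R s t -> size s = size t.
Proof. exact: List.Forall2_length. Qed.

Lemma Forall2_In_l (T U : Type) (R : T -> U -> Prop) s t x :
  Forall2 R s t -> In x s -> exists2 y, In y t & R x y.
Proof.
elim=> // y z s' t' ryz _ IH /= [<-|/IH[u ? ?]]; first by exists z; [left|].
by exists u; [right|].
Qed.

Lemma Forall2_In_r (T U : Type) (R : T -> U -> Prop) s t y :
  Forall2 R s t -> In y t -> exists2 x, In x s & R x y.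
Proof. move=> st; exact: Forall2_In_l (List.Forall2_flip st). Qed.

Lemma Forall2_impl_in (T U : Type) (R R' : T -> U -> Prop) s t :
  (forall x y, In x s -> R x y -> R' x y) -> Forall2 R s t -> Forall2 R' s t.
Proof.
move=> imp st; elim: st imp => // x y s' t' xy _ IH imp.
by constructor; [apply: imp => //; left | apply: IH => u v us; apply: imp; right].
Qed.

Lemma Forall2_refl_in (T : Type) (R : T -> T -> Prop) s :
  (forall x, In x s -> R x x) -> Forall2 R s s.
Proof.
elim: s => // x s IH h; constructor; first by apply: h; left.
by apply: IH => y ys; apply: h; right.
Qed.

Lemma Forall2_comp (T U V : Type) (P : T -> U -> Prop) (Q : U -> V -> Prop) s t u :
  Forall2 P s t -> Forall2 Q t u ->
  Forall2 (fun x z => exists2 y, P x y & Q y z) s u.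
Proof.
move=> st; elim: st u => [|x y s' t' xy _ IH] u tu; inversion tu; subst => //.
by constructor; [exists y | apply: IH].
Qed.

Lemma Forall2_zip (T U : Type) (R : T -> U -> Prop) s t :
  size t = size s -> (forall x y, In (x, y) (zip s t) -> R x y) ->
  Forall2 R s t.
Proof.
elim: s t => [|x s IH] [|y t] //= [e] h; constructor; first by apply: h; left.
by apply: IH => // *; apply: h; right.
Qed.

Lemma Forall2_zip_In (T U : Type) (R : T -> U -> Prop) s t x y :
  Forall2 R s t -> In (x, y) (zip s t) -> R x y.
Proof. by elim=> // u v s' t' uv _ IH /= [[<- <-]|]. Qed.

Lemma Forall2_reshape (T : Type) (R : T -> T -> Prop) (c : seq (seq T)) b :
  Forall2 R (flatten c) b -> exists2 c', b = flatten c' & Forall2 (Forall2 R) c c'.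
Proof.
elim: c b => [|x c IH] b /= h; first by inversion h; exists [::].
have [b1 [b2 [h1 [/IH[c' -> hc'] ->]]]] := List.Forall2_app_inv_l _ _ h.
by exists (b1 :: c') => //; constructor.
Qed.

Lemma Forall2_sumn_map (T : Type) (R : T -> T -> Prop) (w : T -> nat) s t :
  (forall x y, In x s -> R x y -> w x = w y) -> Forall2 R s t ->
  sumn (map w s) = sumn (map w t).
Proof.
move=> e st; elim: st e => //= x y s' t' xy _ IH e.
by rewrite (e x y) ?IH; auto.
Qed.

(** Both recursive clauses of [equiv] have this shape, one on the terms of a sequence and one on the
    arguments of a symbol. *)
Definition perm_lift (T : Type) (R : T -> T -> Prop) (s t : seq T) : Prop :=
  exists2 t', Permutation t t' & Forall2 R s t'.

Section Lift.

Variables (T : Type) (R : T -> T -> Prop).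

Lemma perm_lift_size s t : perm_lift R s t -> size s = size t.
Proof. by case=> t' /Permutation_size -> /Forall2_size. Qed.

Lemma perm_lift_In_l s t x : perm_lift R s t -> In x s -> exists2 y, In y t & R x y.
Proof.
case=> t' tt' st' /(Forall2_In_l st')[y yt' xy]; exists y => //.
exact: Permutation_in (Permutation_sym tt') yt'.
Qed.

Lemma perm_lift_In_r s t y : perm_lift R s t -> In y t -> exists2 x, In x s & R x y.
Proof.
case=> t' tt' st' yt; apply: Forall2_In_r st' _; exact: Permutation_in tt' yt.
Qed.

(** Symmetry is required only at entries of [s], so that an induction hypothesis on their size can
    supply it. *)
Lemma perm_lift_sym s t :
  (forall x y, In x s -> R x y -> R y x) -> perm_lift R s t -> perm_lift R t s.
Proof.
move=> sym [t' tt' st'].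
have /List.Forall2_flip ts : Forall2 (fun x y => R y x) s t'.
  exact: Forall2_impl_in st'.
by have [s' [ss' ts']] := Permutation_Forall2 (Permutation_sym tt') ts; exists s'.
Qed.

Lemma perm_lift_trans s t u :
  (forall x y z, In x s -> R x y -> R y z -> R x z) ->
  perm_lift R s t -> perm_lift R t u -> perm_lift R s u.
Proof.
move=> trans [t' tt' st'] [u' uu' tu'].
have [u'' [uu'' tu'']] := Permutation_Forall2 tt' tu'.
exists u''; first exact: Permutation_trans uu' uu''.
apply: Forall2_impl_in (Forall2_comp st' tu'') => x z xs [y].
exact: trans.
Qed.

Lemma perm_lift_perm_l s s' t : Permutation s s' -> perm_lift R s t -> perm_lift R s' t.
Proof.
move=> ss' [t' tt' st']; have [t'' [tt'' st'']] := Permutation_Forall2 ss' st'.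
by exists t'' => //; apply: Permutation_trans tt''.
Qed.

End Lift.

(** * The equivalence *)

Section Equiv.

Variable G : signature.
Implicit Types (f g : G) (s t : term G) (a b c : sequence G).

Lemma prec_eq_refl f : prec_eq f f.
Proof. by rewrite /prec_eq prec_refl. Qed.

Lemma prec_eq_sym f g : prec_eq f g -> prec_eq g f.
Proof. by rewrite /prec_eq andbC. Qed.

Lemma prec_eq_trans f g e : prec_eq f g -> prec_eq g e -> prec_eq f e.
Proof.
move=> /andP[fg gf] /andP[ge eg]; rewrite /prec_eq.
by rewrite (prec_trans fg ge) (prec_trans eg gf).
Qed.

Lemma prec_gt_eql f g e : prec_eq f g -> prec_gt f e -> prec_gt g e.
Proof.
move=> /andP[fg gf] /andP[fe nef]; rewrite /prec_gt (prec_trans gf fe) /=.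
by apply: contra nef => eg; apply: prec_trans gf.
Qed.

Lemma prec_gt_eqr f g e : prec_eq f g -> prec_gt e f -> prec_gt e g.
Proof.
move=> /andP[fg gf] /andP[fe nef]; rewrite /prec_gt (prec_trans fe fg) /=.
by apply: contra nef => eg; apply: prec_trans eg.
Qed.

Lemma rk_prec_gt f g : prec_gt f g -> rk g < rk f.
Proof. by move=> fg; rewrite [rk f]rkE; apply: leq_bigmax_cond. Qed.

Lemma rk_prec_eq f g : prec_eq f g -> rk f = rk g.
Proof.
move=> fg; rewrite !rkE; apply: eq_bigl => e.
by apply/idP/idP; apply: prec_gt_eql => //; apply: prec_eq_sym.
Qed.

(** Induction measure: passing from a sequence to an argument of one of its terms makes it drop
    ([arg_seq_size]). *)
Fixpoint term_size t : nat :=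
  let: Term _ a := t in (sumn [seq sumn [seq term_size u | u <- x] | x <- a]).+1.

Definition seq_size a : nat := sumn [seq term_size t | t <- a].

Lemma sumn_map_In (T : Type) (w : T -> nat) (x : T) (l : seq T) :
  In x l -> w x <= sumn (map w l).
Proof. by elim: l => //= y l IH [->|/IH]; lia. Qed.

Lemma arg_seq_size f (x : seq (sequence G)) (a b : sequence G) :
  In (Term f x) a -> In b x -> seq_size b < seq_size a.
Proof.
move=> /(sumn_map_In term_size) /= h1 /(sumn_map_In seq_size) h2.
exact: leq_trans h1.
Qed.

(** Reflexivity is the identity permutation and [equiv_term] is absorbed on singletons, so a single
    description remains. *)
Lemma equiv_lift a b :
  equiv a b <-> perm_lift (fun s t => equiv [:: s] [:: t]) a b.
Proof.
split=> [[{}a|{}a {}b b' p h|f g x y y' fg p h]|[b' p h]].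
- by exists a => //; apply: Forall2_refl_in => *; constructor.
- by exists b'.
- exists [:: Term g y] => //; constructor=> //; exact: equiv_term p h.
- exact: equiv_seq p h.
Qed.

(** The clause [equiv_seq] also applies to two singletons and reduces the pair to itself, so
    inversion takes an induction on the derivation. *)
Lemma equiv_term_lift f g (x y : seq (sequence G)) :
  equiv [:: Term f x] [:: Term g y] <-> prec_eq f g /\ perm_lift (@equiv G) x y.
Proof.
split; last by case=> fg [y' p h]; apply: equiv_term p h.
suff H a b : equiv a b -> forall f' g' x' y', a = [:: Term f' x'] ->
    b = [:: Term g' y'] -> prec_eq f' g' /\ perm_lift (@equiv G) x' y'.
  by move=> /H; apply.
move: a b; fix IH 3 => a b [{}a|{}a {}b b' p h|f' g' x' y' y'' fg p h] f1 g1 x1 y1.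
- move=> -> [-> ->]; split; first exact: prec_eq_refl.
  by exists y1 => //; apply: Forall2_refl_in => *; constructor.
- case: h p => [|s t a' b'' st _] p ea eb; first by [].
  case: ea => es _; rewrite eb in p.
  case: (Permutation_length_1_inv p) => et _.
  by apply: (IH _ _ st); [rewrite es | rewrite et].
- by move=> [<- <-] [<- <-]; split=> //; exists y''.
Qed.

(** Lifting twice leads from [a] to its terms and then to their arguments, which are smaller.
    Transitivity follows the same path. *)
Lemma equiv_sym a b : equiv a b -> equiv b a.
Proof.
have [n] := ubnP (seq_size a); elim: n a b => // n IH a b lt /equiv_lift ab.
apply/equiv_lift; apply: perm_lift_sym ab => -[f x] [g y] xa /equiv_term_lift[fg xy].
apply/equiv_term_lift; split; first exact: prec_eq_sym.
apply: perm_lift_sym xy => u v ux; apply: IH.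
exact: leq_trans (arg_seq_size xa ux) lt.
Qed.

Lemma equiv_trans a b c : equiv a b -> equiv b c -> equiv a c.
Proof.
have [n] := ubnP (seq_size a); elim: n a b c => // n IH a b c lt.
move=> /equiv_lift ab /equiv_lift bc; apply/equiv_lift; apply: perm_lift_trans ab bc.
move=> -[f x] [g y] [e z] xa /equiv_term_lift[fg xy] /equiv_term_lift[ge yz].
apply/equiv_term_lift; split; first exact: prec_eq_trans ge.
apply: perm_lift_trans xy yz => u v w ux; apply: IH.
exact: leq_trans (arg_seq_size xa ux) lt.
Qed.

Lemma equiv_perm a b : Permutation a b -> equiv a b.
Proof.
move=> ab; apply/equiv_lift; exists a; first exact: Permutation_sym.
by apply: Forall2_refl_in => *; constructor.
Qed.

Lemma equiv_size a b : equiv a b -> size a = size b.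
Proof. by move/equiv_lift/perm_lift_size. Qed.

Lemma equiv_singletonl f (x : seq (sequence G)) b :
  equiv [:: Term f x] b ->
  exists g y, [/\ b = [:: Term g y], prec_eq f g & perm_lift (@equiv G) x y].
Proof.
move=> e; have := equiv_size e; move: e; case: b => [|[g y] [|]] // e _.
by exists g, y; split=> //; case/equiv_term_lift: e.
Qed.

Lemma Forall2_equiv a b :
  Forall2 (fun s t => equiv [:: s] [:: t]) a b -> equiv a b.
Proof. by move=> h; apply/equiv_lift; exists b. Qed.

Lemma width_term_le f (x : seq (sequence G)) n :
  width_term (Term f x) <= n <-> 0 < n /\ forall a, In a x -> width a <= n.
Proof.
rewrite /=; elim: x => [|a x IH] /=; first by split=> // -[].
rewrite geq_max; split=> [/andP[an /IH[n0 xn]]|[n0 xn]].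
  by split=> // b [<-|/xn].
by rewrite xn; [apply/IH; split=> // b bx; apply: xn; right|left].
Qed.

Lemma width_cat a b : width (a ++ b) = width a + width b.
Proof. by rewrite /width map_cat sumn_cat. Qed.

Lemma width1 t : width [:: t] = width_term t.
Proof. exact: addn0. Qed.

Lemma width_term_gt0 t : 0 < width_term t.
Proof. by case: t => f x; case/width_term_le: (leqnn (width_term (Term f x))). Qed.

Lemma size_le_width a : size a <= width a.
Proof.
by elim: a => //= t a IH; rewrite -cat1s width_cat width1; have := width_term_gt0 t; lia.
Qed.

Lemma width_arg f (x : seq (sequence G)) a : In a x -> width a <= width_term (Term f x).
Proof. by move: a; case/width_term_le: (leqnn (width_term (Term f x))). Qed.

Lemma equiv_width a b : equiv a b -> width a = width b.
Proof.
have [n] := ubnP (seq_size a); elim: n a b => // n IH a b lt /equiv_lift.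
case=> b' /(Permutation_sumn_map (@width_term G)) e ab'; rewrite /width e.
apply: Forall2_sumn_map ab' => -[f x] [g y] xa /equiv_term_lift[_ xy].
have w u v : In u x -> equiv u v -> width u = width v.
  by move=> ux; apply: IH; apply: leq_trans (arg_seq_size xa ux) lt.
apply/eqP; rewrite eqn_leq; apply/andP; split; apply/width_term_le.
  split=> [|u ux]; first exact: width_term_gt0.
  have [v vy uv] := perm_lift_In_l xy ux; rewrite (w _ _ ux uv); exact: width_arg.
split=> [|v vy]; first exact: width_term_gt0.
have [u ux uv] := perm_lift_In_r xy vy; rewrite -(w _ _ ux uv); exact: width_arg.
Qed.

End Equiv.

(** Serves clause 4: when [a] is replaced by an equivalent [a'], the blocks [c] are permuted along
    with the terms. [E] holds of the old pairs, [R] of the new ones. *)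
Lemma zip_perm_lift (T U : Type) (E R : T -> seq U -> Prop) (eqT : T -> T -> Prop)
    (a a' : seq T) (c : seq (seq U)) (a0 : T) c0 :
  (forall t t' b, eqT t t' -> E t b -> R t' b) ->
  perm_lift eqT a a' -> size c = size a ->
  (forall ai ci, In (ai, ci) (zip a c) -> E ai ci) ->
  In (a0, c0) (zip a c) ->
  exists c', [/\ size c' = size a', Permutation (flatten c) (flatten c'),
    forall ai ci, In (ai, ci) (zip a' c') -> R ai ci &
    exists2 a1, eqT a0 a1 & In (a1, c0) (zip a' c')].
Proof.
move=> ER [a'' pa aa''] sc h h0.
have saa := Forall2_size aa''.
have h1 : Forall2 R a'' c.
  have ac : Forall2 E a c by apply: Forall2_zip.
  have := Forall2_comp (List.Forall2_flip aa'') ac.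
  by apply: Forall2_impl_in => t b _ [t' t't t'b]; apply: ER t'b.
have [a1 a01 h01] : exists2 a1, eqT a0 a1 & In (a1, c0) (zip a'' c).
  elim: aa'' c {h1 h} sc h0 {saa pa} => [|t t' s s' tt' _ IH] [|d c] //= [e].
  case=> [[<- <-]|/(IH _ e)[a1 ? ?]]; first by exists t'; [|left].
  by exists a1; [|right].
(* Permuting pairs keeps each block attached to its term. *)
have : Permutation a' (List.map fst (zip a'' c)).
  by rewrite [List.map _ _]unzip1_zip // -saa sc.
move=> /Permutation_map_inv[z [ez pz]]; exists (unzip2 z); split.
- by rewrite ez /unzip2 size_map [RHS](size_map fst).
- apply: Permutation_flatten; rewrite -[X in Permutation X](@unzip2_zip _ _ a'' c) -?saa ?sc //.
  exact: Permutation_map.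
- rewrite ez => ai ci; rewrite [zip _ _]zip_unzip => aci.
  apply: Forall2_zip_In h1 _; exact: Permutation_in (Permutation_sym pz) aci.
- by exists a1 => //; rewrite ez [zip _ _]zip_unzip; apply: Permutation_in pz h01.
Qed.

(** * Closure of the orders under the equivalence *)

Section Orders.

Variables (G : signature) (k : nat).
Implicit Types (f g : G) (s t : term G) (a b c : sequence G) (x y : seq (sequence G)).

Section Induction.

Variable P : nat -> sequence G -> sequence G -> Prop.

(* The generated principles give no induction hypothesis inside the           *)
(* disjunctions and inside [mulext].                                          *)
Lemma sqgt_nested_ind :
  (forall l f x a b, In a x ->
     sqgt k l.+1 a b /\ P l.+1 a b \/ equiv a b -> P l.+1 [:: Term f x] b) ->
  (forall l f g x y, prec_gt f g ->
     (forall b, In b y -> sqgt k l [:: Term f x] b /\ P l [:: Term f x] b) ->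
     size y <= k -> P l.+1 [:: Term f x] [:: Term g y]) ->
  (forall l f x b,
     (forall t, In t b -> sqgt k l [:: Term f x] [:: t] /\ P l [:: Term f x] [:: t]) ->
     size b <= width [:: Term f x] + k -> P l.+1 [:: Term f x] b) ->
  (forall l a b (c : seq (sequence G)) (a0 : term G) c0,
     size c = size a -> equiv b (flatten c) ->
     (forall ai ci, In (ai, ci) (zip a c) ->
        sqgt k l.+1 [:: ai] ci /\ P l.+1 [:: ai] ci \/ equiv [:: ai] ci) ->
     In (a0, c0) (zip a c) -> sqgt k l.+1 [:: a0] c0 -> P l.+1 [:: a0] c0 ->
     size b <= width a + k -> P l.+1 a b) ->
  forall l a b, sqgt k l a b -> P l a b.
Proof.
move=> harg hprec hto hseq; fix IH 4 => l a b.
case=> [{}l f x ai {}b ai_x h|{}l f g x y fg h sz|{}l f x {}b h sz|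
        {}l {}a {}b c a0 c0 sc bc h ac0 h0 sz].
- by apply: harg ai_x _; case: h => h; [left; split=> //; apply: IH|right].
- by apply: hprec => // bj bjy; split; [|apply: IH]; apply: h.
- by apply: hto => // bj bjy; split; [|apply: IH]; apply: h.
- apply: (hseq _ _ _ c a0 c0) => //; last exact: IH.
  by move=> ai ci /h[h'|]; [left; split=> //; apply: IH|right].
Qed.

Lemma gt_nested_ind :
  (forall l a b, sqgt k l a b -> P l a b) ->
  (forall l f x a b, In a x ->
     gt k l.+1 a b /\ P l.+1 a b \/ equiv a b -> P l.+1 [:: Term f x] b) ->
  (forall l f g x y, prec_eq f g ->
     mulext (@equiv G) (fun a b => gt k l.+1 a b /\ P l.+1 a b) x y ->
     size y <= k -> P l.+1 [:: Term f x] [:: Term g y]) ->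
  (forall l f x b1 o b2, size o <= 1 ->
     (forall t, In t o -> gt k l [:: Term f x] [:: t] /\ P l [:: Term f x] [:: t]) ->
     (forall t, In t (b1 ++ b2) -> sqgt k l [:: Term f x] [:: t]) ->
     size (b1 ++ o ++ b2) <= width [:: Term f x] + k ->
     P l.+1 [:: Term f x] (b1 ++ o ++ b2)) ->
  (forall l a b (c : seq (sequence G)) (a0 : term G) c0,
     size c = size a -> equiv b (flatten c) ->
     (forall ai ci, In (ai, ci) (zip a c) ->
        gt k l.+1 [:: ai] ci /\ P l.+1 [:: ai] ci \/ equiv [:: ai] ci) ->
     In (a0, c0) (zip a c) -> gt k l.+1 [:: a0] c0 -> P l.+1 [:: a0] c0 ->
     size b <= width a + k -> P l.+1 a b) ->
  forall l a b, gt k l a b -> P l a b.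
Proof.
move=> hsq harg hmul hto hseq; fix IH 4 => l a b.
case=> [{}l {}a {}b h|{}l f x ai {}b ai_x h|{}l f g x y fg m sz|
        {}l f x b1 o b2 so ho h sz|{}l {}a {}b c a0 c0 sc bc h ac0 h0 sz].
- exact: hsq.
- by apply: harg ai_x _; case: h => h; [left; split=> //; apply: IH|right].
- apply: hmul => //; case: m => u v z z' p1 p2 zz' u0 h.
  apply: Mulext p1 p2 zz' u0 _ => w /h[r ru rw].
  by exists r => //; split=> //; apply: IH.
- by apply: hto => // bj bjy; split; [|apply: IH]; apply: ho.
- apply: (hseq _ _ _ c a0 c0) => //; last exact: IH.
  by move=> ai ci /h[h'|]; [left; split=> //; apply: IH|right].
Qed.

End Induction.

(** Clauses 3 and 4 carry this bound as a premise; clause 2 yields one term, and in clause 1 an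
    argument is no wider than its term. *)
Lemma sqgt_size l a b : sqgt k l a b -> size b <= width a + k.
Proof.
move: l a b; apply: sqgt_nested_ind => // [l f x a b ax h|l f g x y _ _ _].
  rewrite width1; have := width_arg f ax.
  by case: h => [[_]|/equiv_size <-]; have := size_le_width a; lia.
by rewrite width1 /= ; have := width_term_gt0 (Term f x) => /=; lia.
Qed.

Lemma gt_size l a b : gt k l a b -> size b <= width a + k.
Proof.
move: l a b; apply: gt_nested_ind => //.
- exact: sqgt_size.
- move=> l f x a b ax h; rewrite width1; have := width_arg f ax.
  by case: h => [[_]|/equiv_size <-]; have := size_le_width a; lia.
- by move=> l f g x y _ _ _; rewrite width1 /= ;
    have := width_term_gt0 (Term f x) => /=; lia.
Qed.

(** Monotonicity in the index and closure on the left share one induction: every clause is rebuilt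
    on the equivalent sequence. *)
Lemma sqgt_equivl l l' a a' b :
  l <= l' -> equiv a a' -> sqgt k l a b -> sqgt k l' a' b.
Proof.
move=> ll' aa' h; move: l a b h l' a' ll' aa'; apply: sqgt_nested_ind.
- move=> l f x a b ax h [//|l'] a' ll' /equiv_singletonl[g [y [-> fg xy]]].
  have [a1 a1y aa1] := perm_lift_In_l xy ax; apply: sqgt_arg a1y _.
  case: h => [[_ h]|ab]; first by left; apply: h.
  by right; apply: equiv_trans ab; apply: equiv_sym.
- move=> l f g x y fg h sz [//|l'] a' ll' xx'.
  have [g' [x' [e fg' _]]] := equiv_singletonl xx'; rewrite e in xx' *.
  apply: sqgt_prec => //; first exact: prec_gt_eql fg.
  by move=> b /h[_]; apply.
- move=> l f x b h sz [//|l'] a' ll' xx'.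
  have [g' [x' [e fg' _]]] := equiv_singletonl xx'; rewrite e in xx' *.
  apply: sqgt_to_seq; last by rewrite -(equiv_width xx').
  by move=> t /h[_]; apply.
- move=> l a b c a0 c0 sc bc h ac0 h0 IH0 sz [//|l'] a' ll' aa'.
  have /equiv_lift aa1 := aa'.
  have [|c' [sc' pc hc' [a1 a01 ac1]]] := zip_perm_lift
    (R := fun t b => sqgt k l'.+1 [:: t] b \/ equiv [:: t] b) _ aa1 sc h ac0.
    move=> t t' d tt' [[_ IH]|td]; first by left; apply: IH.
    by right; apply: equiv_trans td; apply: equiv_sym.
  apply: (sqgt_seq sc' _ hc' ac1); last by rewrite -(equiv_width aa').
    by apply: equiv_trans bc _; apply: equiv_perm.
  exact: IH0.
Qed.

Lemma gt_equivl l l' a a' b :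
  l <= l' -> equiv a a' -> gt k l a b -> gt k l' a' b.
Proof.
move=> ll' aa' h; move: l a b h l' a' ll' aa'; apply: gt_nested_ind.
- by move=> l a b h l' a' ll' aa'; apply: gt_sqgt; apply: sqgt_equivl h.
- move=> l f x a b ax h [//|l'] a' ll' /equiv_singletonl[g [y [-> fg xy]]].
  have [a1 a1y aa1] := perm_lift_In_l xy ax; apply: gt_arg a1y _.
  case: h => [[_ h]|ab]; first by left; apply: h.
  by right; apply: equiv_trans ab; apply: equiv_sym.
- move=> l f g x y fg m sz [//|l'] a' ll' /equiv_singletonl[f' [x' [-> ff' xx']]].
  apply: gt_mul => //; first by apply: prec_eq_trans fg; apply: prec_eq_sym.
  case: m => u v z z' pu pv zz' u0 h.
  (* Up to permutation, [x'] splits into the image [u'] of the replaced part and the image [w] of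
     the kept part. *)
  have [x'' px xx''] : perm_lift (@equiv G) (u ++ z) x' by apply: perm_lift_perm_l xx'.
  have [u' [w [uu' [zw e]]]] := List.Forall2_app_inv_l _ _ xx''.
  apply: (@Mulext _ _ _ _ _ u' v w z').
  + by move: px; rewrite e.
  + by [].
  + have := Forall2_comp (List.Forall2_flip zw) zz'.
    apply: Forall2_impl_in => p q _ [r rp rq].
    exact: equiv_trans (equiv_sym rp) rq.
  + by move=> e'; move: uu'; rewrite e' => h'; inversion h'; subst.
  + move=> q /h[r ru [_ rq]]; have [r' r'u' rr'] := Forall2_In_l uu' ru.
    by exists r' => //; apply: rq.
- move=> l f x b1 o b2 so ho h sz [//|l'] a' ll' xx'.
  have [g' [x' [e fg' _]]] := equiv_singletonl xx'; rewrite e in xx' *.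
  apply: gt_to_seq => //; last by rewrite -(equiv_width xx').
    by move=> t /ho[_]; apply.
  by move=> t /h; apply: sqgt_equivl.
- move=> l a b c a0 c0 sc bc h ac0 h0 IH0 sz [//|l'] a' ll' aa'.
  have /equiv_lift aa1 := aa'.
  have [|c' [sc' pc hc' [a1 a01 ac1]]] := zip_perm_lift
    (R := fun t b => gt k l'.+1 [:: t] b \/ equiv [:: t] b) _ aa1 sc h ac0.
    move=> t t' d tt' [[_ IH]|td]; first by left; apply: IH.
    by right; apply: equiv_trans td; apply: equiv_sym.
  apply: (gt_seq sc' _ hc' ac1); last by rewrite -(equiv_width aa').
    by apply: equiv_trans bc _; apply: equiv_perm.
  exact: IH0.
Qed.

(** Clause 4 contains an equivalence on the right. Applied to one term and one block, it absorbs
    [equiv b b'] after any other clause, without induction. *)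
Lemma sqgt_equivr l a b b' : equiv b b' -> sqgt k l a b -> sqgt k l a b'.
Proof.
move=> bb' h; have sb := sqgt_size h; rewrite (equiv_size bb') in sb.
have single l' t : sqgt k l'.+1 [:: t] b -> size b' <= width [:: t] + k ->
    sqgt k l'.+1 [:: t] b'.
  move=> tb sb'; apply: (@sqgt_seq _ _ _ _ _ [:: b] t b) => //=.
  - by rewrite cats0; apply: equiv_sym.
  - by move=> ai ci [[<- <-]|//]; left.
  - by left.
case: h bb' single sb => [l' f x ai d ai_x h|l' f g x y fg h sz|l' f x d h sz|
  l' a' d c a0 c0 sc bc h ac0 h0 sz] bb' single sb.
- by apply: single => //; apply: sqgt_arg h.
- by apply: single => //; apply: sqgt_prec.
- by apply: single => //; apply: sqgt_to_seq.
- by apply: (sqgt_seq sc _ h ac0) => //; apply: equiv_trans bc; apply: equiv_sym.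
Qed.

Lemma gt_equivr l a b b' : equiv b b' -> gt k l a b -> gt k l a b'.
Proof.
move=> bb' h; have sb := gt_size h; rewrite (equiv_size bb') in sb.
have single l' t : gt k l'.+1 [:: t] b -> size b' <= width [:: t] + k ->
    gt k l'.+1 [:: t] b'.
  move=> tb sb'; apply: (@gt_seq _ _ _ _ _ [:: b] t b) => //=.
  - by rewrite cats0; apply: equiv_sym.
  - by move=> ai ci [[<- <-]|//]; left.
  - by left.
case: h bb' single sb => [l' a' d h|l' f x ai d ai_x h|l' f g x y fg m sz|
  l' f x b1 o b2 so ho h sz|l' a' d c a0 c0 sc bc h ac0 h0 sz] bb' single sb.
- by apply: gt_sqgt; apply: sqgt_equivr h.
- by apply: single => //; apply: gt_arg h.
- by apply: single => //; apply: gt_mul.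
- by apply: single => //; apply: gt_to_seq.
- by apply: (gt_seq sc _ h ac0) => //; apply: equiv_trans bc; apply: equiv_sym.
Qed.

(** * Inversion and decomposition of a step *)

Definition sqgt_rules l f x b : Prop :=
  exists2 l', l = l'.+1 &
  [\/ exists2 a, In a x & sqgt k l a b \/ equiv a b,
      exists g y, [/\ b = [:: Term g y], prec_gt f g, size y <= k &
        forall d, In d y -> sqgt k l' [:: Term f x] d] |
      size b <= width [:: Term f x] + k /\
        forall t, In t b -> sqgt k l' [:: Term f x] [:: t]].

(** Clause 4 on a singleton has one block, equivalent to [b] and reached by a smaller derivation.
    Generalising the target up to equivalence eliminates this clause. *)
Lemma sqgt_term_inv l f x b : sqgt k l [:: Term f x] b -> sqgt_rules l f x b.
Proof.
suff H a : sqgt k l a b -> forall f' x' b', a = [:: Term f' x'] ->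
    equiv b b' -> sqgt_rules l f' x' b'.
  by move=> /H; apply=> //; apply: equiv_refl.
move: l a b {f x}; apply: sqgt_nested_ind.
- move=> l f x a b ax h f' x' b' [<- <-] bb'; exists l => //.
  apply: Or31; exists a => //; case: h => [[h _]|ab].
    by left; apply: sqgt_equivr h.
  by right; apply: equiv_trans bb'.
- move=> l f g x y fg h sz f' x' b' [<- <-] /equiv_singletonl[g' [y' [-> gg' yy']]].
  exists l => //; apply: Or32; exists g', y'; split=> //.
  + exact: prec_gt_eqr fg.
  + by rewrite -(perm_lift_size yy').
  + move=> d /(perm_lift_In_r yy')[e /h[he _] ed]; exact: sqgt_equivr he.
- move=> l f x b h sz f' x' b' [<- <-] bb'; exists l => //; apply: Or33; split.
    by rewrite -(equiv_size bb').
  have /equiv_lift bl := bb' => t /(perm_lift_In_r bl)[e /h[he _] ed].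
  exact: sqgt_equivr he.
- move=> l a b c a0 c0 sc bc h ac0 h0 IH sz f x b' ea bb'; move: sc ac0.
  rewrite ea; case: c h bc => [|c1 [|]] // h bc _ /= [] // [e1 e2].
  apply: IH; first by rewrite -e1.
  apply: equiv_trans bb'; rewrite -e2.
  by move: bc => /equiv_sym; rewrite /= cats0.
Qed.

(** In clause 3 a permutation brings the exceptional term to the front, since equivalence may
    reorder the target. *)
Definition gt_rules l f x b : Prop :=
  sqgt k l [:: Term f x] b \/
  exists2 l', l = l'.+1 &
  [\/ exists2 a, In a x & gt k l a b \/ equiv a b,
      exists g y, [/\ b = [:: Term g y], prec_eq f g, size y <= k &
        mulext (@equiv G) (gt k l) x y] |
      exists o b', [/\ Permutation b (o ++ b'), size o <= 1,
        size b <= width [:: Term f x] + k,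
        forall t, In t o -> gt k l' [:: Term f x] [:: t] &
        forall t, In t b' -> sqgt k l' [:: Term f x] [:: t]]].

Lemma gt_term_inv l f x b : gt k l [:: Term f x] b -> gt_rules l f x b.
Proof.
suff H a : gt k l a b -> forall f' x' b', a = [:: Term f' x'] ->
    equiv b b' -> gt_rules l f' x' b'.
  by move=> /H; apply=> //; apply: equiv_refl.
move: l a b {f x}; apply: gt_nested_ind.
- by move=> l a b h f x b' ea bb'; left; rewrite -ea; apply: sqgt_equivr h.
- move=> l f x a b ax h f' x' b' [<- <-] bb'; right; exists l => //.
  apply: Or31; exists a => //; case: h => [[h _]|ab].
    by left; apply: gt_equivr h.
  by right; apply: equiv_trans bb'.
- move=> l f g x y fg m sz f' x' b' [<- <-] /equiv_singletonl[g' [y' [-> gg' yy']]].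
  right; exists l => //; apply: Or32; exists g', y'; split=> //.
  + exact: prec_eq_trans gg'.
  + by rewrite -(perm_lift_size yy').
  + case: m => u v z z' pu pv zz' u0 h.
    have [y'' py yy''] : perm_lift (@equiv G) (v ++ z') y' by apply: perm_lift_perm_l yy'.
    have [v' [w [vv' [zw e]]]] := List.Forall2_app_inv_l _ _ yy''.
    apply: (@Mulext _ _ _ _ _ u v' z w) => //.
    * by move: py; rewrite e.
    * have := Forall2_comp zz' zw.
      by apply: Forall2_impl_in => p q _ [r]; apply: equiv_trans.
    * move=> q /(Forall2_In_r vv')[r /h[p pu' [pr _]] rq].
      by exists p => //; apply: gt_equivr pr.
- move=> l f x b1 o b2 so ho h sz f' x' b' [<- <-] bb'.
  right; exists l => //; apply: Or33.
  have /equiv_lift bl := bb'.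
  have [b'' pb] : perm_lift (fun s t => equiv [:: s] [:: t]) (o ++ (b1 ++ b2)) b'.
    apply: perm_lift_perm_l bl; rewrite !catA.
    by apply: Permutation_app_tail; apply: Permutation_app_comm.
  move=> /(List.Forall2_app_inv_l o)[o' [r [oo' [br e]]]].
  exists o', r; split.
  + by move: pb; rewrite e.
  + by rewrite -(Forall2_size oo').
  + by rewrite -(equiv_size bb').
  + move=> t /(Forall2_In_r oo')[u /ho[uo _] ut]; exact: gt_equivr uo.
  + move=> t /(Forall2_In_r br)[u /h uo ut]; exact: sqgt_equivr uo.
- move=> l a b c a0 c0 sc bc h ac0 h0 IH sz f x b' ea bb'; move: sc ac0.
  rewrite ea; case: c h bc => [|c1 [|]] // h bc _ /= [] // [e1 e2].
  apply: IH; first by rewrite -e1.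
  apply: equiv_trans bb'; rewrite -e2.
  by move: bc => /equiv_sym; rewrite /= cats0.
Qed.

Lemma zip_Forall2_r (T U V : Type) (R : U -> V -> Prop) (p : seq T) q r u v :
  Forall2 R q r -> In (u, v) (zip p q) -> exists2 w, R v w & In (u, w) (zip p r).
Proof.
move=> qr; elim: qr p => [|e e' q' r' ee' _ IH] [|u' p] //=.
by case=> [[<- <-]|/IH[w ? ?]]; [exists e'; [|left] | exists w; [|right]].
Qed.

(** The equivalence of clause 4 is pushed into the blocks, which leaves a permutation; under the
    other clauses [a] is one term and [b] its only block. A step thus acts on each term
    separately. *)
Lemma gt_decomp l a b :
  gt k l a b ->
  exists c : seq (sequence G), [/\ Permutation b (flatten c),
    Forall2 (fun t d => gt k l [:: t] d \/ equiv [:: t] d) a c &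
    exists t d, In (t, d) (zip a c) /\ gt k l [:: t] d].
Proof.
have split_seq (c : seq (sequence G)) t d : size c = size a -> equiv b (flatten c) ->
    (forall ai ci, In (ai, ci) (zip a c) ->
       gt k l [:: ai] ci \/ equiv [:: ai] ci) ->
    In (t, d) (zip a c) -> gt k l [:: t] d ->
    exists c' : seq (sequence G), [/\ Permutation b (flatten c'),
      Forall2 (fun t d => gt k l [:: t] d \/ equiv [:: t] d) a c' &
      exists t d, In (t, d) (zip a c') /\ gt k l [:: t] d].
  move=> sc /equiv_sym/equiv_lift[b' pb /Forall2_reshape[c' eb cc']] h itd td.
  exists c'; split; first by rewrite -eb.
    have ac := Forall2_zip sc h.
    apply: Forall2_impl_in (Forall2_comp ac cc') => u w _ [v uv /Forall2_equiv vw].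
    case: uv => uv; first by left; apply: gt_equivr uv.
    by right; apply: equiv_trans vw.
  have [w /Forall2_equiv dw itw] := zip_Forall2_r cc' itd.
  by exists t, w; split=> //; apply: gt_equivr td.
have single t : a = [:: t] -> gt k l [:: t] b ->
    exists c' : seq (sequence G), [/\ Permutation b (flatten c'),
      Forall2 (fun t d => gt k l [:: t] d \/ equiv [:: t] d) a c' &
      exists t d, In (t, d) (zip a c') /\ gt k l [:: t] d].
  move=> -> tb; exists [:: b]; split; first by rewrite /= cats0.
    by constructor=> //; left.
  by exists t, b; split=> //; left.
move=> ab; case: (ab) split_seq single => {ab}.
- move=> {}l {}a {}b h; case: h => [l' f x ai d ai_x h|l' f g x y fg h sz|l' f x d h sz|
    l' a' d c a0 c0 sc bc h ac0 h0 sz] split_seq single.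
  + by apply: single => //; apply: gt_sqgt; apply: sqgt_arg h.
  + by apply: single => //; apply: gt_sqgt; apply: sqgt_prec.
  + by apply: single => //; apply: gt_sqgt; apply: sqgt_to_seq.
  + apply: (split_seq c a0 c0) => //; last exact: gt_sqgt.
    by move=> ai ci /h[?|?]; [left; apply: gt_sqgt|right].
- move=> l' f x ai d ai_x h split_seq single.
  by apply: single => //; apply: gt_arg h.
- move=> l' f g x y fg m sz split_seq single.
  by apply: single => //; apply: gt_mul.
- move=> l' f x b1 o b2 so ho h sz split_seq single.
  by apply: single => //; apply: gt_to_seq.
- by move=> l' a' d c a0 c0 sc bc h ac0 h0 sz split_seq single; apply: (split_seq c a0 c0).
Qed.

End Orders.

(** * Heights *)

Section Height.

Variables (G : signature) (k : nat).
Implicit Types (f g : G) (t : term G) (a b : sequence G) (x y : seq (sequence G)).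

(* [height_le n a] bounds by n the sum, over the terms t of a, of             *)
(* 1 + max {height c | t >_k c ground}.  On ground sequences this height      *)
(* turns out to be Slow - 1, but it is additive by construction.              *)
Inductive height_le : nat -> sequence G -> Prop :=
| height_nil n : height_le n [::]
| height_cons t a n1 n2 n :
    (forall c, ground c -> gt k k [:: t] c -> height_le n1 c) ->
    height_le n2 a -> n1.+1 + n2 <= n -> height_le n (t :: a).

Lemma height_consE n t a : height_le n (t :: a) ->
  exists n1 n2, [/\ n1.+1 + n2 <= n, height_le n2 a &
    forall c, ground c -> gt k k [:: t] c -> height_le n1 c].
Proof. by move=> h; inversion h; subst; exists n1, n2. Qed.

Lemma height_leW m n a : m <= n -> height_le m a -> height_le n a.
Proof.
case: a => [|t a] mn; first by constructor.
case/height_consE=> n1 [n2 [le ha ht]].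
exact: height_cons ht ha (leq_trans le mn).
Qed.

Lemma height_cat m n a b :
  height_le m a -> height_le n b -> height_le (m + n) (a ++ b).
Proof.
elim: a m => [|t a IH] m /=; first by move=> _; apply: height_leW; lia.
case/height_consE=> n1 [n2 [le ha ht]] hb.
by apply: height_cons ht (IH _ ha hb) _; lia.
Qed.

Lemma height_catE n a b : height_le n (a ++ b) ->
  exists n1 n2, [/\ n1 + n2 <= n, height_le n1 a & height_le n2 b].
Proof.
elim: a n => [|t a IH] n /= h; first by exists 0, n; split=> //; constructor.
case/height_consE: h => n1 [n2 [le /IH[m1 [m2 [le' ha hb]]] ht]].
by exists (n1.+1 + m1), m2; split=> //; [lia|apply: height_cons ht ha _].
Qed.

Lemma height_perm n a b : Permutation a b -> height_le n a -> height_le n b.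
Proof.
move=> p; elim: p n => // [t a' b' _ IH|s t a'|a1 a2 a3 _ IH1 _ IH2] n.
- case/height_consE=> n1 [n2 [le ha ht]].
  exact: height_cons ht (IH _ ha) le.
- case/height_consE=> n1 [n2 [le /height_consE[m1 [m2 [le' ha ht]]] hs]].
  by apply: (height_cons (n2 := n1.+1 + m2) ht); [apply: height_cons hs ha _|lia].
- by move/IH1/IH2.
Qed.

(** Equivalent terms have the same successors, by [gt_equivl]. *)
Lemma height_equiv n a b : equiv a b -> height_le n a -> height_le n b.
Proof.
move=> /equiv_lift[b' pb ab' ha]; apply: height_perm (Permutation_sym pb) _.
elim: ab' n ha => // s t a' b'' st _ IH n /height_consE[n1 [n2 [le ha ht]]].
apply: height_cons (IH _ ha) le => c gc tc; apply: ht => //.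
by apply: gt_equivl tc => //; apply: equiv_sym.
Qed.

Lemma ground_perm a b : Permutation a b -> ground a = ground b.
Proof. exact: Permutation_all. Qed.

(** By [gt_decomp] each term gives way to its own block, of no larger height; at least one block is
    a successor of its term, so the sum drops. *)
Lemma height_gt n a b : ground b -> gt k k a b -> height_le n a ->
  exists2 m, m < n & height_le m b.
Proof.
move=> gb /gt_decomp[c [pb ac [t [d [itd td]]]]] ha.
have gc : ground (flatten c) by rewrite -(ground_perm pb).
suff [m mn hm] : exists2 m, m < n & height_le m (flatten c).
  by exists m => //; apply: height_perm hm; apply: Permutation_sym.
have weak n' s e : ground e -> gt k k [:: s] e \/ equiv [:: s] e ->
    height_le n' [:: s] -> height_le n' e.
  move=> ge [se|se]; last exact: height_equiv.
  case/height_consE=> n1 [n2 [le _ hs]]; apply: height_leW (hs _ ge se); lia.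
have weaks s e : Forall2 (fun t d => gt k k [:: t] d \/ equiv [:: t] d) s e ->
    forall n', ground (flatten e) -> height_le n' s -> height_le n' (flatten e).
  elim=> [|u v s' e' uv _ IH] n' //=; rewrite /ground all_cat => /andP[gv ge].
  move=> /(@height_catE _ [:: u])[n1 [n2 [le hu hs]]].
  apply: height_leW le _; apply: height_cat; last exact: IH.
  exact: weak uv hu.
elim: ac n ha itd gc {pb} => // u v s' e' uv se' IH n.
move=> hus iuv /=; rewrite /ground all_cat => /andP[gv ge].
case: iuv => [[eu ev]|its].
  case/height_consE: hus => n1 [n2 [le hs hu]]; exists (n1 + n2); first lia.
  apply: height_cat; last exact: weaks ge hs.
  by apply: hu => //; rewrite eu ev.
have [n1 [n2 [le hu hs]]] := @height_catE _ [:: u] _ hus.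
have [m lt hm] := IH _ hs its ge; exists (n1 + m); first lia.
by apply: height_cat hm; apply: weak uv hu.
Qed.

Lemma height_ge n a b :
  ground b -> gt k k a b \/ equiv a b -> height_le n a -> height_le n b.
Proof.
move=> gb [ab|ab] ha; last exact: height_equiv ab ha.
have [m lt] := height_gt gb ab ha; apply: height_leW; exact: ltnW.
Qed.

Lemma ground_term_args f x : ground [:: Term f x] -> forall a, In a x -> ground a.
Proof. by rewrite /ground /= andbT => /andP[_ /In_all]. Qed.

Lemma gt_arg_term f x a : 0 < k -> In a x -> gt k k [:: Term f x] a.
Proof. by case: (k) => // l _ ax; apply: gt_arg ax _; right; constructor. Qed.

(** Clause 3 with no terms on the right: a term can be erased, which makes the tail of a sequence
    one of its successors. *)
Lemma gt_term_nil t : 0 < k -> gt k k [:: t] [::].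
Proof.
case: t => f x; case: (k) => // l _; apply: gt_sqgt.
by apply: sqgt_to_seq.
Qed.

(** An argument is a successor of its term, so by induction its width is below the height of the
    term. This turns the width bound of clause 3 into a bound by heights. *)
Lemma width_le_height n a : 0 < k -> ground a -> height_le n a -> width a <= n.
Proof.
move=> k0 ga h; elim: h ga => // -[f x] a' n1 n2 n' _ IH _ IHa le gta.
have /andP[gfx ga] := gta.
rewrite -cat1s width_cat width1; apply: leq_trans le.
apply: leq_add (IHa ga); apply/width_term_le; split=> // b bx.
have gb : ground b.
  by apply: (@ground_term_args f x) => //; rewrite /ground /= andbT.
by apply: leqW; apply: IH => //; apply: gt_arg_term.
Qed.

Lemma height_terms n b : (forall t, In t b -> height_le n [:: t]) ->
  height_le (size b * n) b.
Proof.
elim: b => [|t b IH] h; first by constructor.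
rewrite mulSn -cat1s; apply: height_cat; first by apply: h; left.
by apply: IH => u ub; apply: h; right.
Qed.

Lemma height_term n t :
  (forall c, ground c -> gt k k [:: t] c -> height_le n c) -> height_le n.+1 [:: t].
Proof. by move=> h; apply: height_cons h (height_nil 0) _; lia. Qed.

End Height.

(** * Multisets of bounded numbers *)

Lemma In_mem (T : eqType) (x : T) (s : seq T) : In x s <-> x \in s.
Proof.
elim: s => //= y s IH; rewrite inE; split=> [[->|/IH ->]|/predU1P[->|/IH]].
all: by rewrite ?eqxx ?orbT; auto.
Qed.

Lemma Permutation_perm_eq (T : eqType) (s t : seq T) : Permutation s t -> perm_eq s t.
Proof.
elim=> [|x s' t' _|x y s'|s1 s2 s3 _ h1 _]; rewrite ?perm_cons //.
  by rewrite -[_ :: _ :: _]/([:: y] ++ [:: x] ++ s') perm_catCA.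
exact: seq.perm_trans.
Qed.

Lemma Forall2_choice (T U : Type) (R : T -> U -> Prop) (s : seq U) :
  (forall y, In y s -> exists x, R x y) -> exists r, Forall2 R r s.
Proof.
elim: s => [|y s IH] h; first by exists [::].
have [x xy] := h y (or_introl erefl).
have [r rs] := IH (fun z zs => h z (or_intror zs)).
by exists (x :: r); constructor.
Qed.

(* The number whose base-c digits, of weights c^(k-1), c^(k-2), ..., are s.   *)
Fixpoint digits_val (c k : nat) (s : seq nat) : nat :=
  if s is d :: s' then d * c ^ k.-1 + digits_val c k.-1 s' else 0.

Lemma digits_val_lt c k s :
  0 < c -> all (fun d => d < c) s -> size s <= k -> digits_val c k s < c ^ k.
Proof.
move=> c0; elim: s k => [|d s IH] [|k] //=; rewrite ?expn_gt0 ?c0 //.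
move=> /andP[dc sc] sk; have := IH k sc sk; rewrite expnS => lt.
(* The lower digits together stay below one unit of the leading weight. *)
apply: (@leq_trans (d.+1 * c ^ k)); first by rewrite mulSn; lia.
exact: leq_mul.
Qed.

(* Dershowitz-Manna descent is lexicographic descent of the sorted lists.     *)
Lemma digits_val_mul c k s t u v z :
  sorted geq s -> sorted geq t -> size s <= k -> size t <= k ->
  all (fun d => 0 < d < c) s ->
  perm_eq s (u ++ z) -> perm_eq t (v ++ z) -> u != [::] ->
  (forall q, q \in v -> exists2 p, p \in u & q < p) ->
  digits_val c k t < digits_val c k s.
Proof.
elim: s k t z => [|M s IH] k t z ss st sk tk alls su tv u0 uv.
  by have := perm_size su; rewrite size_cat; case: (u) u0.
have leM q : q \in M :: s -> q <= M.
  rewrite inE => /predU1P[->//|qs]; move: ss => /= /(order_path_min _) /allP.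
  by apply=> // ? ? ?; lia.
have leuz q : q \in u ++ z -> q <= M by rewrite -(perm_mem su); apply: leM.
have ltv q : q \in v -> q < M.
  by move=> /uv[p pu lt]; apply: leq_trans lt _; apply: leuz; rewrite mem_cat pu.
have /andP[/andP[M0 Mc] allM] := alls.
case: k sk tk => // k sk tk.
(* If the largest entry [M] of [s] is kept, it leads [t] as well and the two leading digits
   cancel. *)
have [Mz|Mz] := boolP (M \in z).
  have pz := perm_to_rem Mz; set z' := rem M z in pz.
  have cons w : perm_eq (w ++ z) (M :: (w ++ z')).
    by rewrite -cat1s -[M :: _]/([:: M] ++ _) perm_sym perm_catCA perm_cat2l perm_sym.
  have {}tv := seq.perm_trans tv (cons v); have {}su := seq.perm_trans su (cons u).
  rewrite perm_cons in su.
  case: t st tk tv => [|M' t] st tk tv; first by have := perm_size tv.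
  have eM : M' = M.
    have : M' \in M :: (v ++ z') by rewrite -(perm_mem tv) inE eqxx.
    have : M \in M' :: t by rewrite (perm_mem tv) inE eqxx.
    rewrite inE => /predU1P[//|Mt]; rewrite inE => /predU1P[//|M'vz].
    have : M <= M'.
      by move: st => /= /(order_path_min _) /allP; apply=> // ? ? ?; lia.
    have : M' <= M; last by lia.
    move: M'vz; rewrite mem_cat => /orP[/ltv/ltnW //|/mem_rem M'z].
    by apply: leuz; rewrite mem_cat M'z orbT.
  rewrite eM perm_cons in tv; rewrite eM /= ltn_add2l.
  apply: IH su tv u0 uv => //; [exact: path_sorted ss|exact: path_sorted st].
(* Otherwise every entry of [t] is below [M], and the leading digit drops. *)
have ltt q : q \in t -> q < M.
  rewrite (perm_mem tv) mem_cat => /orP[/ltv //|qz].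
  rewrite ltn_neqAle leuz ?mem_cat ?qz ?orbT // andbT.
  by apply: contraNneq Mz => <-.
have c0 : 0 < c by lia.
apply: (@leq_trans (M * c ^ k)); last by rewrite /= leq_addr.
(* For empty [t] the value is 0, and positivity of the digit [M] gives the strict inequality. *)
case: t tk ltt {st tv} => [|d t] tk ltt; first by rewrite muln_gt0 M0 expn_gt0 c0.
have allt : all (fun e => e < c) t.
  by apply/allP => e et; apply: leq_trans (ltt e _) (ltnW Mc); rewrite inE et orbT.
have := digits_val_lt c0 allt tk.
have dM : d < M by apply: ltt; rewrite inE eqxx.
rewrite /= => lt; apply: (@leq_trans (d.+1 * c ^ k)); first by rewrite mulSn; lia.
by rewrite leq_mul2r dM orbT.
Qed.

(* Shifting the entries by one makes the measure see entries equal to 0.      *)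
Definition mul_measure (k m : nat) (s : seq nat) : nat :=
  digits_val m.+2 k (sort geq (map S s)).

Lemma geq_total : total geq.
Proof. by move=> p q; apply: leq_total. Qed.

Lemma mul_measure_lt k m s : size s <= k -> all (fun n => n <= m) s ->
  mul_measure k m s < m.+2 ^ k.
Proof.
move=> sk sm; apply: digits_val_lt => //; last by rewrite size_sort size_map.
by rewrite all_sort all_map; apply: sub_all sm => n /=; rewrite !ltnS.
Qed.

Lemma mul_measure_mul k m s t u v z :
  size s <= k -> size t <= k -> all (fun n => n <= m) s ->
  perm_eq s (u ++ z) -> perm_eq t (v ++ z) -> u != [::] ->
  (forall q, q \in v -> exists2 p, p \in u & q < p) ->
  mul_measure k m t < mul_measure k m s.
Proof.
move=> sk tk sm su tv u0 uv.
apply: (@digits_val_mul _ _ _ _ (map S u) (map S v) (map S z)).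
- exact: sort_sorted geq_total _.
- exact: sort_sorted geq_total _.
- by rewrite size_sort size_map.
- by rewrite size_sort size_map.
- by rewrite all_sort all_map; apply: sub_all sm => n /=; rewrite !ltnS.
- by rewrite perm_sort -map_cat perm_map.
- by rewrite perm_sort -map_cat perm_map.
- by case: (u) u0.
- move=> _ /mapP[q /uv[p pu lt] ->]; exists p.+1; last by rewrite ltnS.
  exact: map_f.
Qed.

(** * Bounds on the height of a term *)

(** The summands pay for clauses 1, 2 and 3 in turn: an argument, a smaller symbol whose height [q]
    bounds in terms of its argument heights, and at most [m.+1 + k] terms. A sum replaces the
    maximum. *)
Fixpoint sq_bound (k : nat) (q : nat -> nat) (l m : nat) : nat :=
  if l is l'.+1 then
    m + q (sq_bound k q l' m) + (m.+1 + k) * sq_bound k q l' m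
  else 0.

(** Height of a term beyond that of the one successor with an equivalent symbol: an argument, an
    auxiliary step, and up to [k] nested uses of clause 3. *)
Definition step_cost (k : nat) (q : nat -> nat) (m : nat) : nat :=
  (m + sq_bound k q k m + k * ((m.+1 + k) * sq_bound k q k m)).+1.

(** Here [p] is a strict bound on the rank, so 0 admits no symbol. The power bounds the values of
    [mul_measure]. *)
Fixpoint term_bound (k p m : nat) : nat :=
  if p is p'.+1 then m.+2 ^ k * step_cost k (term_bound k p') m else 0.

Section Bounds.

Variables (G : signature) (k : nat).
Hypothesis k_gt0 : 0 < k.
Implicit Types (f g : G) (t : term G) (a b : sequence G) (x y : seq (sequence G)).

Local Notation height_le := (@height_le G k).

Section OneTerm.

Variables (f : G) (x : seq (sequence G)) (m : nat) (q : nat -> nat).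
Hypothesis ground_x : ground [:: Term f x].
Hypothesis height_x : forall a, In a x -> height_le m a.
(** [q] stands for the bound already known for smaller symbols. *)
Hypothesis height_lower : forall g y n,
  prec_gt f g -> size y <= k -> ground [:: Term g y] ->
  (forall b, In b y -> height_le n b) -> height_le (q n) [:: Term g y].

(** The successor covers [m = 0], as a term has width at least 1. *)
Lemma term_width_le : width [:: Term f x] <= m.+1.
Proof.
rewrite width1; apply/width_term_le; split=> // a ax; apply: leqW.
apply: (width_le_height k_gt0) (height_x ax); exact: ground_term_args ground_x _ ax.
Qed.

Lemma sqgt_height l b : l <= k -> ground b -> sqgt k l [:: Term f x] b ->
  height_le (sq_bound k q l m) b.
Proof.
elim: l b => [|l IH] b lk gb /sqgt_term_inv[] // l' [<-] /= {l'}.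
case=> [[a ax ab]|[g [y [eb fg sy hy]]]|[sb hb]].
- apply: (@height_leW _ _ m); first by lia.
  apply: (height_ge gb _ (height_x ax)); case: ab => ab; last by right.
  (* Heights refer to index [k], so the step is raised to it. *)
  by left; apply: gt_equivl lk (equiv_refl _) _; apply: gt_sqgt.
- rewrite eb in gb *; apply: (height_leW _ (height_lower fg sy gb _)); last first.
    by move=> d dy; apply: IH (ltnW lk) _ (hy d dy); apply: ground_term_args gb _ dy.
  by lia.
- apply: (height_leW _ (height_terms _)); last first.
    move=> t tb; apply: IH (ltnW lk) _ (hb t tb).
    by rewrite /ground /= andbT; move/In_all: gb; apply.
  have := leq_mul (leq_trans sb (leq_add term_width_le (leqnn k)))
    (leqnn (sq_bound k q l m)); lia.
Qed.

Variable r : nat.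
Hypothesis height_mul : forall g y,
  prec_eq f g -> size y <= k -> ground [:: Term g y] ->
  mulext (@equiv G) (gt k k) x y -> height_le r [:: Term g y].

(** Clause 3 passes the full order on to at most one term, so [r] is charged once, with coefficient
    1; each use of the clause adds only terms of auxiliary height. Hence costs along a multiset
    descent add up instead of multiplying. *)
Lemma gt_height l b : l <= k -> ground b -> gt k l [:: Term f x] b ->
  height_le (r + (m + sq_bound k q k m + l * ((m.+1 + k) * sq_bound k q k m))) b.
Proof.
have sq l' b' : l' <= k -> ground b' -> sqgt k l' [:: Term f x] b' ->
    height_le (sq_bound k q k m) b'.
  move=> lk gb fb; apply: sqgt_height => //.
  exact: sqgt_equivl lk (equiv_refl _) fb.
elim: l b => [|l IH] b lk gb.
  by case/gt_term_inv=> [h|[]] //; apply: height_leW (sq _ _ lk gb h); lia.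
case/gt_term_inv=> [h|[l' [<-] {l'}]].
  by apply: height_leW (sq _ _ lk gb h); lia.
case=> [[a ax ab]|[g [y [eb fg sy hy]]]|[o [b' [pb so sb ho hb]]]].
- apply: (@height_leW _ _ m); first by lia.
  apply: (height_ge gb _ (height_x ax)); case: ab => ab; last by right.
  by left; apply: gt_equivl lk (equiv_refl _) ab.
- rewrite eb in gb *; apply: (@height_leW _ _ r); first by lia.
  apply: height_mul => //; case: hy => u v z z' pu pv zz' u0 h.
  apply: Mulext pu pv zz' u0 _ => d /h[e eu ed]; exists e => //.
  exact: gt_equivl lk (equiv_refl _) ed.
- apply: height_perm (Permutation_sym pb) _.
  rewrite (ground_perm pb) /ground all_cat in gb; have /andP[go gb'] := gb.
  set W := (_ + k) * _.
  apply: (@height_leW _ _ (r + (m + sq_bound k q k m + l * W) + W)).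
    by rewrite mulSn; lia.
  apply: (@height_cat _ _ _ W).
    case: o so go ho {pb gb} => [|t [|]] // _ go ho; first exact: height_nil.
    exact: IH [:: t] (ltnW lk) go (ho t (or_introl erefl)).
  apply: (height_leW _ (height_terms _)); last first.
    move=> t tb; apply: sq (ltnW lk) _ (hb t tb).
    by rewrite /ground /= andbT; move/In_all: gb'; apply.
  apply: leq_mul => //; apply: leq_trans (leq_trans sb _).
    by rewrite (Permutation_size pb) size_cat leq_addl.
  by rewrite leq_add2r term_width_le.
Qed.

Lemma height_term_step : height_le (r + step_cost k q m) [:: Term f x].
Proof.
by rewrite /step_cost addnS; apply: height_term => c gc; apply: gt_height.
Qed.

End OneTerm.

(** Numerical shadow of a multiset step: a new entry gets a number below that of the entry
    dominating it, and a kept entry retains its number. *)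
Lemma mulext_heights m x y s :
  (forall b, In b y -> ground b) -> size x <= k -> size y <= k ->
  Forall2 height_le s x -> all (fun n => n <= m) s ->
  mulext (@equiv G) (gt k k) x y ->
  exists r, [/\ Forall2 height_le r y, all (fun n => n <= m) r &
    mul_measure k m r < mul_measure k m s].
Proof.
move=> gy sx sy hs sm [u v z z' pu pv zz' u0 huv].
have [s' [ps /List.Forall2_flip hs']] := Permutation_Forall2 pu (List.Forall2_flip hs).
have [nu [nz [hu [hz es]]]] := List.Forall2_app_inv_r _ _ hs'.
have gv b : In b (v ++ z') -> ground b.
  by move=> bvz; apply: gy; apply: Permutation_in (Permutation_sym pv) bvz.
have [nv hv] : exists nv, Forall2
    (fun n b => height_le n b /\ exists2 p, In p nu & n < p) nv v.
  apply: Forall2_choice => b bv; have [a au ab] := huv b bv.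
  have [p pnu hp] := Forall2_In_r hu au.
  have [n np hn] := height_gt (gv b (proj2 (In_cat _ _ _) (or_introl bv))) ab hp.
  by exists n; split=> //; exists p.
have hz' : Forall2 height_le nz z'.
  apply: Forall2_impl_in (Forall2_comp hz zz') => n b _ [a ha ab].
  exact: height_equiv ab ha.
have hvz : Forall2 height_le (nv ++ nz) (v ++ z').
  apply: List.Forall2_app hz'; by apply: Forall2_impl_in hv => n b _ [].
have [r [pr /List.Forall2_flip hr]] :=
  Permutation_Forall2 (Permutation_sym pv) (List.Forall2_flip hvz).
have ltnv n : n \in nv -> exists2 p, p \in nu & n < p.
  move=> /In_mem /(Forall2_In_l hv)[b _ [_ [p /In_mem pnu lt]]].
  by exists p.
have ps1 : perm_eq s (nu ++ nz) by rewrite -[nu ++ nz]es; apply: Permutation_perm_eq.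
have pr1 : perm_eq r (nv ++ nz).
  by rewrite perm_sym; apply: Permutation_perm_eq.
move: (sm); rewrite (perm_all _ ps1) all_cat => /andP[mu mz].
exists r; split=> //.
  rewrite (perm_all _ pr1) all_cat mz andbT; apply/allP => n /ltnv[p pu' lt].
  by move/allP: mu => /(_ p pu') /(leq_trans (ltnW lt)).
apply: mul_measure_mul ps1 pr1 _ ltnv => //.
- by rewrite (Forall2_size hs).
- by rewrite (Forall2_size hr).
- by apply/eqP => e; apply: u0; have := Forall2_size hu; rewrite e; case: (u).
Qed.

(** Each entry of [y] is a successor of, or equivalent to, an entry of [x]. This crude bound serves
    [height_exists], where [x] may have more than [k] entries. *)
Lemma mulext_height_le m x y :
  (forall b, In b y -> ground b) -> (forall a, In a x -> height_le m a) ->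
  mulext (@equiv G) (gt k k) x y -> forall b, In b y -> height_le m b.
Proof.
move=> gy hx [u v z z' pu pv zz' u0 huv] b yb; have gb := gy b yb.
have [a ax ab] : exists2 a, In a x & gt k k a b \/ equiv a b.
  have uzx a : In a (u ++ z) -> In a x.
    exact: Permutation_in (Permutation_sym pu).
  have /In_cat[/huv[a au ab]|/(Forall2_In_r zz')[a az ab]] := Permutation_in _ pv yb.
    by exists a; [apply: uzx; apply/In_cat; left|left].
  by exists a; [apply: uzx; apply/In_cat; right|right].
exact: height_ge gb ab (hx a ax).
Qed.

Lemma heights_seq m x : (forall a, In a x -> height_le m a) ->
  Forall2 height_le (nseq (size x) m) x.
Proof.
elim: x => [|a x IH] h; constructor; first by apply: h; left.
by apply: IH => b bx; apply: h; right.
Qed.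

(** Outer induction on the rank; inside it [m] is fixed and [v] bounds the measure of the argument
    heights. A multiset step to an equivalent symbol lowers the measure, so one [step_cost] is paid
    per unit of [v]. *)
Lemma height_term_bound p f x m :
  rk f < p -> size x <= k -> ground [:: Term f x] ->
  (forall a, In a x -> height_le m a) ->
  height_le (term_bound k p m) [:: Term f x].
Proof.
elim: p f x m => // p IHp f x m fp sx gx hx /=.
set c := step_cost _ _ _.
suff H v : forall g y s, rk g < p.+1 -> size y <= k -> ground [:: Term g y] ->
    Forall2 height_le s y -> all (fun n => n <= m) s -> mul_measure k m s < v ->
    height_le (v * c) [:: Term g y].
  apply: H (heights_seq hx) _ _ => //.
    by rewrite all_nseq leqnn orbT.
  apply: mul_measure_lt; rewrite ?size_nseq //.
  by rewrite all_nseq leqnn orbT.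
elim: v => // v IHv g y s gp sy gy hs sm lt; rewrite mulSn addnC.
have hy a : In a y -> height_le m a.
  move=> /(Forall2_In_r hs)[n /In_mem /(allP sm) nm]; exact: height_leW.
apply: height_term_step => //.
  move=> e z n ge sz gz; apply: IHp => //; by have := rk_prec_gt ge; lia.
move=> e z ge sz gz m'.
have [r [hr rm lt']] := mulext_heights (ground_term_args gz) sy sz hs sm m'.
apply: IHv hr rm _ => //; first by rewrite -(rk_prec_eq ge).
exact: leq_trans lt' _.
Qed.

(** This is termination of [gt] at index [k] on ground sequences. Arguments have heights by
    induction on size, and finitely many of them share a bound. *)
Lemma height_exists a : ground a -> exists n, height_le n a.
Proof.
have [n] := ubnP (seq_size a); elim: n a => // n IH; elim=> [|[f x] a IHa].
  by exists 0; constructor.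
rewrite /seq_size /= => lt /andP[gx ga].
have {IHa ga}[n2 ha] : exists m, height_le m a.
  by apply: IHa ga; rewrite /seq_size; lia.
have {}gx : ground [:: Term f x] by rewrite /ground /= andbT.
have {IH lt}hx b : In b x -> exists m, height_le m b.
  move=> bx; apply: IH; last exact: ground_term_args gx _ bx.
  by have := sumn_map_In (@seq_size G) bx; rewrite {2}/seq_size; lia.
have [m {}hx] : exists m, forall b, In b x -> height_le m b.
  elim: x hx {gx} => [|b x IHx] hx; first by exists 0.
  have [m hm] := IHx (fun d dx => hx d (or_intror dx)).
  have [m' hm'] := hx b (or_introl erefl); exists (m + m') => d [<-|dx].
    by apply: height_leW hm'; lia.
  by apply: height_leW (hm d dx); lia.
suff [n1 h1] : exists n1, height_le n1 [:: Term f x].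
  by exists (n1 + n2); apply: height_cat h1 ha.
(* The arity of [f] may exceed [k], so one step is unfolded first: the terms that clause 2 of either
   order yields have at most [k] arguments, and [height_term_bound] applies to them. *)
exists (term_bound k (rk f).+1 m + step_cost k (term_bound k (rk f)) m).
apply: height_term_step => //.
  move=> g y n' fg sy gy hy; apply: height_term_bound => //; exact: rk_prec_gt.
move=> g y fg sy gy xy; apply: height_term_bound => //.
  by rewrite (rk_prec_eq fg).
exact: mulext_height_le (ground_term_args gy) hx xy.
Qed.

End Bounds.

(** * Slow and heights *)

Lemma ex_least (P : nat -> Prop) :
  (exists n, P n) -> exists2 n, P n & forall m, P m -> n <= m.
Proof.
move=> exP; pose p n : bool := if excluded_middle_informative (P n) then true else false.
have pP n : p n <-> P n by rewrite /p; case: excluded_middle_informative.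
have exp : exists n, p n by have [n /pP] := exP; exists n.
by have [n /pP Pn min] := ex_minnP exp; exists n => // m /pP /min.
Qed.

Lemma bounded_is_max (S : nat -> Prop) (N : nat) :
  (forall n, S n -> n <= N) -> exists v, is_max S v.
Proof.
move=> SN; have [v ub least] := ex_least (ex_intro (fun v => forall n, S n -> n <= v) N SN).
exists v; split=> //; case: (excluded_middle_informative (S v)) => [|Sv]; [by left|right].
(* If the least bound [v] is not attained but [S] is inhabited, [v.-1] is a bound too, a
   contradiction. *)
have S0 n : ~ S n.
  move=> Sn; have nv : n < v.
    by rewrite ltn_neqAle ub // andbT; apply/eqP => e; apply: Sv; rewrite -e.
  have : v <= v.-1; last by lia.
  apply: least => m Sm; have := ub m Sm; rewrite leq_eqVlt => /predU1P[e|]; last by lia.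
  by case: Sv; rewrite -e.
by split=> //; apply/eqP; rewrite -leqn0; apply: least => n /S0.
Qed.

Lemma setmax_le (S : nat -> Prop) (N : nat) :
  (forall n, S n -> n <= N) -> setmax S <= N.
Proof.
move=> SN; have := epsilon_spec (inhabits 0) _ (bounded_is_max SN).
by rewrite -/(setmax S) => -[_ [/SN|[_ ->]]].
Qed.

Section Slow.

Variables (G : signature) (k : nat).
Hypothesis k_gt0 : 0 < k.
Implicit Types (f : G) (t : term G) (a b : sequence G) (x : seq (sequence G)).

(** Bounds the length of descending chains from [a], with no reference to sums over terms. Its least
    value plus one solves the equation of [Slow]. *)
Fixpoint steps_le (n : nat) (a : sequence G) : Prop :=
  forall b, ground b -> gt k k a b -> if n is n'.+1 then steps_le n' b else False.

Lemma steps_leW m n a : m <= n -> steps_le m a -> steps_le n a.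
Proof.
elim: m n a => [|m IH] [|n] a //= mn h b gb ab; first by case: (h b gb ab).
by apply: IH (h b gb ab).
Qed.

Lemma height_steps n a : height_le k n a -> steps_le n a.
Proof.
elim: n a => [|n IH] a ha b gb ab; have [m mn hb] := height_gt gb ab ha => //.
by apply: IH; apply: height_leW hb.
Qed.

Lemma slow_equation_solvable : exists s, @slow_equation G k s.
Proof.
have leastP a : exists n, ground a ->
    steps_le n a /\ forall m, steps_le m a -> n <= m.
  case ga: (ground a); last by exists 0.
  have [n ha] := height_exists k_gt0 ga.
  have [m sm min] := ex_least (ex_intro (steps_le^~ a) n (height_steps ha)).
  by exists m.
(* The least chain length as a function; its value on sequences that are not ground is arbitrary. *)
pose D a := epsilon (inhabits 0)
  (fun n => ground a -> steps_le n a /\ forall m, steps_le m a -> n <= m).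
have DP a : ground a -> steps_le (D a) a /\ forall m, steps_le m a -> D a <= m.
  exact: (epsilon_spec (inhabits 0) _ (leastP a)).
exists (fun a => 1 + D a) => a ga; have [Da minD] := DP a ga.
have ub b : ground b -> gt k k a b -> 1 + D b <= D a.
  move=> gb ab; case: (D a) Da => [|n] /= /(_ b gb ab) // sb.
  by rewrite add1n ltnS; case: (DP b gb) => _; apply.
have [|v [vub vin]] := @bounded_is_max
    (fun n => exists b, [/\ ground b, gt k k a b & n = 1 + D b]) (D a).
  by move=> n [b [gb ab ->]]; apply: ub.
exists v; first by split.
congr (_ + _); apply/eqP; rewrite eqn_leq; apply/andP; split.
  apply: minD; case: v vub {vin} => [|v] vub b gb ab.
    by have := vub _ (ex_intro _ b (And3 gb ab erefl)).
  have := vub _ (ex_intro _ b (And3 gb ab erefl)); rewrite add1n ltnS => le.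
  by apply: steps_leW le _; case: (DP b gb).
by case: vin => [[b [gb ab ->]]|[_ ->]] //; apply: ub.
Qed.

Lemma SlowP : @slow_equation G k (@Slow G k).
Proof. exact: epsilon_spec slow_equation_solvable. Qed.

Lemma Slow_gt a b : ground a -> ground b -> gt k k a b -> Slow k b < Slow k a.
Proof.
move=> ga gb ab; have [v [ub _] ->] := SlowP ga.
by rewrite add1n ltnS; apply: ub; exists b.
Qed.

(** Together with [height_Slow] this identifies [Slow] on ground sequences with the least height
    plus one. *)
Lemma Slow_height n a : ground a -> height_le k n a -> Slow k a <= n.+1.
Proof.
elim/ltn_ind: n a => n IH a ga ha; have [v [_ vin] ->] := SlowP ga.
rewrite add1n ltnS; case: vin => [[b [gb ab ->]]|[_ ->]] //.
by have [m mn hb] := height_gt gb ab ha; apply: leq_trans (IH m mn b gb hb) _.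
Qed.

(** Clause 4 with the tail kept as singleton blocks; its length premise holds because a sequence is
    at most as long as it is wide. *)
Lemma gt_cat l t a c : 0 < l -> gt k l [:: t] c -> gt k l (t :: a) (c ++ a).
Proof.
case: l => // l _ tc; have sc := gt_size tc.
apply: (@gt_seq _ _ _ _ _ (c :: [seq [:: u] | u <- a]) t c) => //=.
- by rewrite size_map.
- by rewrite flatten_seq1; constructor.
- move=> ai ci [[<- <-]|]; first by left.
  move=> h; right; elim: a h => //= u a IH [[<- <-]|//]; exact: equiv_refl.
- by left.
- rewrite size_cat -cat1s width_cat; have := size_le_width a; lia.
Qed.

(* The tail a contributes its least height n2, so that what remains of n      *)
(* bounds every successor of the head t.                                      *)
Lemma height_Slow n a : ground a -> Slow k a <= n.+1 -> height_le k n a.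
Proof.
elim: n a => [|n IH] [|t a] gta; try by constructor.
  (* For [n = 0] a nonempty sequence is impossible: its tail is a successor, and [Slow] is at least
     1 there. *)
  have /andP[_ ga] := gta; have := Slow_gt gta ga (gt_cat a k_gt0 (gt_term_nil t k_gt0)).
  have [v _ ->] := SlowP ga; lia.
move=> le; have /andP[_ ga] := gta.
have tail c : ground c -> gt k k [:: t] c -> height_le k n (c ++ a).
  move=> gc tc; have gca : ground (c ++ a) by rewrite /ground all_cat; apply/andP.
  by apply: IH => //; have := Slow_gt gta gca (gt_cat a k_gt0 tc); lia.
have [n2 ha min] := ex_least (ex_intro (height_le k ^~ a) n
  (tail [::] isT (gt_term_nil t k_gt0))).
have n2n : n2 <= n by apply: min; apply: (tail [::]) => //; apply: gt_term_nil.
apply: (@height_cons _ _ _ _ (n - n2) n2) => // [c gc tc|]; last by lia.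
have [m1 [m2 [le' hc /min le2]]] := height_catE (tail c gc tc).
by apply: height_leW hc; lia.
Qed.

(** The base of the powers is positive, so the summand of an entry is at least that entry. This weak
    bound suffices to control the argument heights. *)
Lemma Slow_le_MSlow x a : In a x -> Slow k a <= MSlow k x.
Proof.
move=> ax; rewrite /MSlow /h; set s := map _ x; set c := 1 + _.
have /In_mem : In (Slow k a) s by apply: (List.in_map (Slow k)).
rewrite -(mem_sort geq) => sa; set j := index (Slow k a) (sort geq s).
have js : j < size s by rewrite -(size_sort geq) index_mem.
(* The sum counts positions from 1, hence [j.+1]. *)
rewrite (bigD1_seq j.+1) ?iota_uniq ?mem_index_iota //=.
by rewrite nth_index //; apply: leq_trans (leq_addr _ _); rewrite leq_pmulr // expn_gt0.
Qed.

Lemma Slow_term_le p f x m :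
  ground [:: Term f x] -> rk f <= p -> size x <= k -> MSlow k x <= m ->
  Slow k [:: Term f x] <= (term_bound k p.+1 m).+1.
Proof.
move=> gx fp sx xm; apply: Slow_height => //; apply: height_term_bound => // a ax.
apply: height_Slow; first exact: ground_term_args gx _ ax.
exact: leqW (leq_trans (Slow_le_MSlow ax) xm).
Qed.

End Slow.

(** * Polynomial bounds *)

Definition poly_le (q : nat -> nat) : Prop :=
  exists c d, forall m, q m <= c * (m + 2) ^ d.

Lemma poly_le_const n : poly_le (fun=> n).
Proof. by exists n, 0 => m; rewrite expn0 muln1. Qed.

Lemma poly_le_id : poly_le id.
Proof. by exists 1, 1 => m /=; lia. Qed.

Lemma poly_leD p q : poly_le p -> poly_le q -> poly_le (fun m => p m + q m).
Proof.
move=> [c [d pc]] [c' [d' qc]]; exists (c + c'), (d + d') => m.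
rewrite mulnDl; apply: leq_add.
  by apply: leq_trans (pc m) _; rewrite leq_mul2l leq_pexp2l ?orbT //; lia.
by apply: leq_trans (qc m) _; rewrite leq_mul2l leq_pexp2l ?orbT //; lia.
Qed.

Lemma poly_leM p q : poly_le p -> poly_le q -> poly_le (fun m => p m * q m).
Proof.
move=> [c [d pc]] [c' [d' qc]]; exists (c * c'), (d + d') => m.
by rewrite expnD mulnACA; apply: leq_mul.
Qed.

Lemma poly_leX q n : poly_le q -> poly_le (fun m => q m ^ n).
Proof.
move=> hq; elim: n => [|n IH]; first exact: poly_le_const.
have [c [d h]] := poly_leM hq IH; exists c, d => m; rewrite expnS; exact: h.
Qed.

(** The bound of [p] is taken at [q m], and the result is again built from [q] by sums, products and
    powers. *)
Lemma poly_le_comp p q : poly_le p -> poly_le q -> poly_le (fun m => p (q m)).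
Proof.
move=> [c [d pc]] hq.
have [c' [d' h]] : poly_le (fun m => c * (q m + 2) ^ d).
  apply: poly_leM; first exact: poly_le_const.
  by apply: poly_leX; apply: poly_leD hq _; apply: poly_le_const.
by exists c', d' => m; apply: leq_trans (pc _) (h m).
Qed.

Lemma poly_leS q : poly_le q -> poly_le (fun m => (q m).+1).
Proof.
move=> hq; have [c [d h]] := poly_leD hq (poly_le_const 1).
by exists c, d => m; rewrite -addn1.
Qed.

Lemma poly_le_sq_bound k q l : poly_le q -> poly_le (sq_bound k q l).
Proof.
move=> hq; elim: l => [|l IH]; first exact: poly_le_const.
apply: poly_leD; first by apply: poly_leD poly_le_id _; apply: poly_le_comp.
apply: poly_leM IH; apply: poly_leD; last exact: poly_le_const.
exact: poly_leS poly_le_id.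
Qed.

(** The recursions have depth [p] and [k] and the power has exponent [k], all independent of [m], so
    only boundedly many polynomials are composed. *)
Lemma poly_le_term_bound k p : poly_le (term_bound k p).
Proof.
elim: p => [|p IH]; first exact: poly_le_const.
have P := poly_le_sq_bound k k IH.
apply: poly_leM.
  by apply: poly_leX; apply: poly_leS; apply: poly_leS; apply: poly_le_id.
apply: poly_leS; apply: poly_leD; first exact: poly_leD poly_le_id P.
apply: poly_leM; first exact: poly_le_const.
apply: poly_leM P; apply: poly_leD; last exact: poly_le_const.
exact: poly_leS poly_le_id.
Qed.

Theorem theorem5p15 (k p : nat) (hk : 1 <= k) :
  exists c d : nat, forall (G : signature) (m : nat),
    F G k p m <= c * (m + 2) ^ d.
Proof.
(* [p.+1] turns the rank bound into a strict one, and the outer successor is the gap between [Slow]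
   and height. *)
have [c [d bound]] := poly_leS (poly_le_term_bound k p.+1).
exists c, d => G m; apply: leq_trans (bound m).
(* A uniform bound on the members also ensures that the maximum exists. *)
apply: setmax_le => _ [f [x [gx fp sx xm ->]]].
exact: Slow_term_le.
Qed.
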